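(* Let $k\ge 1$ be an integer and let $\mathcal H$ be a finite ABA-free hypergraph. Then the vertices of $\mathcal H$ can be colored with $k$ colors such that every hyperedge $A\in\mathcal H$ with $|A|\ge 2k-1$ contains vertices of all $k$ colors.
   Context: A hypergraph $\mathcal H$ with an ordered vertex set is ABA-free if it does not contain two hyperedges $A$ and $B$ for which there are three vertices $x<y<z$ such that $x,z\in A\setminus B$ and $y\in B\setminus A$. A hypergraph with an unordered vertex set is ABA-free if its vertices have an ordering with which it is ABA-free. *)

(* Defs.v *)
From mathcomp Require Import all_boot.

Set Implicit Arguments.
Unset Strict Implicit.
Unset Printing Implicit Defensive.

(* A finite hypergraph is a finite vertex type T with a set of hyperedges
   H : {set {set T}}. A vertex ordering is given by its non-strict relation le. *)

Definition linear_order (T : eqType) (le : rel T) : Prop :=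
  [/\ reflexive le, antisymmetric le, transitive le & total le].

Definition strict (T : eqType) (le : rel T) : rel T :=
  fun x y => (x != y) && le x y.

Definition ordered_ABA_free (T : finType) (le : rel T) (H : {set {set T}}) : Prop :=
  ~ exists A B : {set T}, [/\ A \in H, B \in H &
      exists x y z : T,
        [/\ strict le x y, strict le y z,
            x \in A :\: B, z \in A :\: B & y \in B :\: A]].

Definition ABA_free (T : finType) (H : {set {set T}}) : Prop :=
  exists2 le : rel T, linear_order le & ordered_ABA_free le H.

(* Main.v *)
Require Import Defs.
From mathcomp Require Import all_boot.
From mathcomp Require Import zify.

Set Implicit Arguments.
Unset Strict Implicit.
Unset Printing Implicit Defensive.

(** The coloring is built one color class at a time.  A vertex is called
    skippable if some hyperedge missing it has vertices on both sides of it.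

    Every nonempty hyperedge [A] contains an unskippable vertex
    ([unskippable_in_edge]).  The point is that deleting a skippable vertex [w]
    from all hyperedges leaves every other skippable vertex skippable: if [B]
    skips [p] but [w] is the only vertex of [B] left of [p], then ABA-freeness
    forces a hyperedge skipping [w] to skip [p] too, and symmetrically on the
    right ([skipped_setU1]).  So if all vertices of [A] were skippable, each
    [p] in [A] would be skipped by some hyperedge [B] having vertices of
    [B :\: A] on both sides of [p]: a forbidden pattern.

    Now let [M] be an antichain of nonempty hyperedges, and [R] an
    inclusion-minimal set of unskippable vertices meeting every member of [M].
    Then [R] meets each [A] in [M] at most twice ([minimal_hitting_card]): if
    [a < b < c] lie in both [A] and [R], then by minimality of [R] some [B] in [M]
    meets [R] only in [b]; as [a] and [c] are unskippable, [B] lies strictly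
    between [a] and [c], so ABA-freeness gives [B \subset A], which is impossible
    in an antichain since [B] misses [a].

    For the induction on the number of colors, let [M] consist of the
    inclusion-minimal hyperedges of size at least [2 * k.+1 - 1].  Giving a new
    color to [R] and deleting [R] costs each member of [M] at most two vertices,
    so the trace of [M] outside [R] can be colored with [k] colors.  A large
    hyperedge contains a member of [M], so it sees all the colors. *)

(** * Strict orders and ABA-freeness *)

(** The ABA-free condition in contrapositive form, for an arbitrary relation [lt]
    in the role of the strict order; in this form it is visibly invariant under
    reversing [lt]. *)
Definition aba_free (T : finType) (lt : rel T) (H : {set {set T}}) : Prop :=
  forall A B x y z, A \in H -> B \in H -> lt x y -> lt y z ->
    x \in A -> x \notin B -> y \in B -> y \notin A -> z \in A -> z \in B.

Lemma aba_free_rev (T : finType) (lt : rel T) (H : {set {set T}}) :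
  aba_free lt H -> aba_free (fun x y => lt y x) H.
Proof.
move=> free A B x y z AH BH yx zy xA xB yB yA zA.
apply: contraNT xB => zB; exact: (free A B z y x).
Qed.

Lemma strict_aba_free (T : finType) (le : rel T) (H : {set {set T}}) :
  ordered_ABA_free le H -> aba_free (strict le) H.
Proof.
move=> free A B x y z AH BH xy yz xA xB yB yA zA.
apply/negPn/negP => zB; apply: free.
by exists A, B; split=> //; exists x, y, z; rewrite !inE xA xB yB yA zA zB.
Qed.

Lemma strict_total (T : eqType) (le : rel T) :
  linear_order le -> forall x y, x != y -> strict le x y || strict le y x.
Proof.
by case=> _ _ _ tot x y nxy; rewrite /strict nxy eq_sym nxy /= tot.
Qed.

Lemma strict_trans (T : eqType) (le : rel T) :
  linear_order le -> transitive (strict le).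
Proof.
case=> _ anti tr _ y x z /andP[nxy xy] /andP[nyz yz].
rewrite /strict (tr _ _ _ xy yz) andbT; apply: contraNneq nxy => xz.
by rewrite -xz in yz; apply/eqP/anti; rewrite xy.
Qed.

Lemma card_gt2_chain (T : finType) (lt : rel T) (S : {set T}) :
  (forall x y, x != y -> lt x y || lt y x) -> 2 < #|S| ->
  exists a b c, [/\ a \in S, b \in S & c \in S] /\ lt a b /\ lt b c.
Proof.
move=> tot /card_gt2P[x [y [z [[xS yS zS] [nxy nyz nzx]]]]].
case/orP: (tot _ _ nxy) => xy; case/orP: (tot _ _ nyz) => yz;
  case/orP: (tot _ _ nzx) => zx.
- by exists x, y, z.
- by exists x, y, z.
- by exists z, x, y.
- by exists x, z, y.
- by exists y, z, x.
- by exists y, x, z.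
- by exists z, y, x.
- by exists z, y, x.
Qed.

(** * Skippable vertices *)

(** [p] is skippable once the vertices of [W] have been deleted from all
    hyperedges: some hyperedge misses [p] and has vertices outside [W] on both
    sides of [p].  The vertex [p] itself may belong to [W]; skippability proper is
    the case [W = set0]. *)
Definition skipped (T : finType) (lt : rel T) (H : {set {set T}}) (W : {set T})
    (p : T) : bool :=
  [exists B in H, (p \notin B) &&
    [exists x in B :\: W, exists z in B :\: W, lt x p && lt p z]].

Lemma skippedP (T : finType) (lt : rel T) (H : {set {set T}}) (W : {set T}) p :
  reflect (exists B x z, [/\ B \in H, p \notin B, x \in B :\: W, z \in B :\: W
                          & lt x p && lt p z])
          (skipped lt H W p).
Proof.
apply: (iffP exists_inP) => [[B BH /andP[pB]]|[B [x [z [BH pB xB zB xpz]]]]].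
  by case/exists_inP=> x xB /exists_inP[z zB xpz]; exists B, x, z.
exists B; rewrite // pB; apply/exists_inP; exists x => //.
by apply/exists_inP; exists z.
Qed.

Lemma skipped_rev (T : finType) (lt : rel T) (H : {set {set T}}) W p :
  skipped (fun x y => lt y x) H W p = skipped lt H W p.
Proof.
by apply/skippedP/skippedP=> -[B [x [z [BH pB xB zB xpz]]]];
  exists B, z, x; split=> //; rewrite andbC.
Qed.

(** The case where the deleted vertex [w] lies to the left of [p] in a hyperedge
    [B] that skips [p]. *)
Lemma skipped_setU1_left (T : finType) (lt : rel T) (H : {set {set T}})
    (W B : {set T}) (p w z : T) :
  (forall x y, x != y -> lt x y || lt y x) -> transitive lt -> aba_free lt H ->
  B \in H -> p \notin B -> w \in B -> lt w p ->
  z \in B :\: (w |: W) -> lt p z -> skipped lt H W w ->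
  skipped lt H (w |: W) p.
Proof.
move=> tot tr free BH pB wB wp zB pz /skippedP[C [c1 [c2]]].
rewrite !in_setD => -[CH wC /andP[c1W c1C] /andP[c2W c2C] /andP[c1w wc2]].
have neqw u : u \in C -> u != w by apply: contraTneq => ->.
(* If [B] keeps another vertex left of [p], it still skips [p]; otherwise the
   hyperedge [C] skipping [w] turns out to skip [p]. *)
have [left_other|only_w] :=
  boolP [exists x in B, (x \notin w |: W) && lt x p].
  case/exists_inP: left_other => x xB /andP[xW xp].
  by apply/skippedP; exists B, x, z; rewrite in_setD xB xW xp pz.
have noB u : u \in C -> u \notin W -> lt u p -> u \notin B.
  move=> uC uW up; apply: contra only_w => uB; apply/exists_inP; exists u => //.
  by rewrite up in_setU1 negb_or neqw // uW.
have c1B : c1 \notin B by apply: noB => //; apply: tr c1w wp.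
(* Since [c1] is in [C :\: B] and [w] in [B :\: C], the part of [C] right of [w]
   lies in [B], hence avoids the gap between [w] and [p] as well as [p]. *)
have rightB u : u \in C -> lt w u -> u \in B.
  by move=> uC wu; apply: (free C B c1 w u).
have pC : p \notin C by apply: contra pB => pC; apply: rightB.
have pc2 : lt p c2.
  have /tot/orP[//|c2p] : p != c2 by apply: contraNneq pC => ->.
  by have := noB _ c2C c2W c2p; rewrite rightB.
apply/skippedP; exists C, c1, c2.
by rewrite !in_setD !in_setU1 !negb_or !neqw ?c1W ?c2W ?c1C ?c2C ?(tr _ _ _ c1w wp).
Qed.

(** Deleting a skippable vertex preserves skippability. *)
Lemma skipped_setU1 (T : finType) (lt : rel T) (H : {set {set T}})
    (W : {set T}) (p w : T) :
  (forall x y, x != y -> lt x y || lt y x) -> transitive lt -> irreflexive lt ->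
  aba_free lt H -> skipped lt H W p -> skipped lt H W w ->
  skipped lt H (w |: W) p.
Proof.
move=> tot tr irr free /skippedP[B [x [z]]].
rewrite !in_setD => -[BH pB /andP[xW xB] /andP[zW zB] /andP[xp pz]] skw.
have nxz : x != z.
  by apply: contraTneq (tr _ _ _ xp pz) => ->; rewrite irr.
(* At most one of the witnesses [x], [z] equals [w]; the right-hand case reduces
   to the left-hand one by reversing the order. *)
have [xw|nxw] := eqVneq x w.
  apply: (skipped_setU1_left (B := B) (z := z)) => //; rewrite -?xw //.
  by rewrite in_setD zB in_setU1 negb_or eq_sym nxz zW.
have [zw|nzw] := eqVneq z w.
  rewrite -skipped_rev.
  apply: (skipped_setU1_left (B := B) (z := x)) => //; rewrite -?zw //.
  - by move=> u v nuv; rewrite orbC tot.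
  - by move=> u v t vu ut; apply: tr ut vu.
  - exact: aba_free_rev.
  - by rewrite in_setD xB in_setU1 negb_or nxz xW.
  - by rewrite skipped_rev zw.
apply/skippedP; exists B, x, z.
by rewrite !in_setD !in_setU1 !negb_or nxw nzw xW zW xB zB xp pz.
Qed.

Lemma unskippable_in_edge (T : finType) (lt : rel T) (H : {set {set T}})
    (A : {set T}) :
  (forall x y, x != y -> lt x y || lt y x) -> transitive lt -> irreflexive lt ->
  aba_free lt H -> A \in H -> A != set0 ->
  exists2 p, p \in A & ~~ skipped lt H set0 p.
Proof.
move=> tot tr irr free AH A0; apply/exists_inP; rewrite -negb_forall_in.
apply/negP=> /forall_inP sk.
(* Deleting the vertices of [W] one at a time keeps all of [A] skippable. *)
have skW n (W : {set T}) : #|W| = n -> W \subset A ->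
    forall p, p \in A -> skipped lt H W p.
  elim: n W => [|n IHn] W cW WA p pA.
    by move/eqP: cW; rewrite cards_eq0 => /eqP ->; apply: sk.
  have /card_gt0P[w wW] : 0 < #|W| by rewrite cW.
  have cW' : #|W :\ w| = n by move: cW; rewrite (cardsD1 w) wW => -[].
  have WA' : W :\ w \subset A by apply: subset_trans WA; apply: subD1set.
  rewrite -(setD1K wW); apply: skipped_setU1 => //; apply: IHn => //.
  exact: subsetP WA _ wW.
case/set0Pn: A0 => p pA.
have /skippedP[B [x [z]]] := skW _ A erefl (subxx A) p pA.
rewrite !in_setD => -[BH pB /andP[xA xB] /andP[zA zB] /andP[xp pz]].
by have := free B A x p z BH AH xp pz xB xA pA pB zB; rewrite (negPf zA).
Qed.

(** * Shallow hitting sets *)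

(** [R] consists of unskippable vertices and meets every member of [M]. *)
Definition unskippable_hitting (T : finType) (lt : rel T) (M : {set {set T}})
    (R : {set T}) : bool :=
  [forall x in R, ~~ skipped lt M set0 x] && [forall A in M, A :&: R != set0].

Lemma minimal_hitting_card (T : finType) (lt : rel T) (M : {set {set T}})
    (R A : {set T}) :
  (forall x y, x != y -> lt x y || lt y x) -> transitive lt -> irreflexive lt ->
  aba_free lt M ->
  {in M &, forall B C : {set T}, B \subset C -> B = C} ->
  minset (unskippable_hitting lt M) R -> A \in M -> #|A :&: R| <= 2.
Proof.
move=> tot tr irr free anti /minsetP[/andP[/forall_inP unsk /forall_inP hit] minR].
move=> AM; rewrite leqNgt; apply/negP => /(card_gt2_chain tot).
case=> a [b [c [[]]]]; rewrite !inE.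
move=> /andP[aA aR] /andP[bA bR] /andP[cA cR] [ab bc].
have [B BM BRb] : exists2 B, B \in M & B :&: (R :\ b) = set0.
  have nhit : ~~ [forall B in M, B :&: (R :\ b) != set0].
    apply/negP => hit'; have /setP/(_ b) : R :\ b = R.
      apply: minR; last exact: subD1set.
      rewrite /unskippable_hitting hit' andbT; apply/forall_inP => x.
      by rewrite !inE => /andP[_]; apply: unsk.
    by rewrite !inE bR eqxx.
  move: nhit; rewrite negb_forall_in => /exists_inP[B BM].
  by rewrite negbK => /eqP; exists B.
have onlyb x : x \in B -> x \in R -> x = b.
  move=> xB xR; apply/eqP/negPn/negP => nxb.
  by have := in_set0 x; rewrite -BRb !inE xB nxb xR.
have bB : b \in B.
  by have /set0Pn[x] := hit B BM; rewrite inE => /andP[xB xR]; rewrite -(onlyb x).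
have aB : a \notin B.
  by apply: contraTN ab => aB; rewrite (onlyb a) // irr.
have cB : c \notin B.
  by apply: contraTN bc => cB; rewrite (onlyb c) // irr.
have sBA : B \subset A.
  apply/subsetP => x xB; apply/negPn/negP => xA.
  have ax : lt a x.
    have /tot/orP[//|xa] : a != x by apply: contraNneq aB => ->.
    case/negP: (unsk a aR); apply/skippedP.
    by exists B, x, b; rewrite !setD0 BM aB xB bB xa ab.
  have xc : lt x c.
    have /tot/orP[//|cx] : x != c by apply: contraNneq cB => <-.
    case/negP: (unsk c cR); apply/skippedP.
    by exists B, b, x; rewrite !setD0 BM cB xB bB cx bc.
  by have := free A B a x c AM BM ax xc aA aB xB xA cA; rewrite (negPf cB).
by have eBA := anti B A BM AM sBA; rewrite eBA aA in aB.
Qed.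

Lemma shallow_hitting_set (T : finType) (lt : rel T) (M : {set {set T}}) :
  (forall x y, x != y -> lt x y || lt y x) -> transitive lt -> irreflexive lt ->
  aba_free lt M -> set0 \notin M ->
  {in M &, forall B C : {set T}, B \subset C -> B = C} ->
  exists R : {set T}, forall A, A \in M -> A :&: R != set0 /\ #|A :&: R| <= 2.
Proof.
move=> tot tr irr free M0 anti.
have hitU : unskippable_hitting lt M [set x | ~~ skipped lt M set0 x].
  apply/andP; split; first by apply/forall_inP => x; rewrite inE.
  apply/forall_inP => A AM.
  have A0 : A != set0 by apply: contraNneq M0 => <-.
  have [p pA skp] := unskippable_in_edge tot tr irr free AM A0.
  by apply/set0Pn; exists p; rewrite !inE pA skp.
have [R minR _] := minset_exists hitU; exists R => A AM; split.
  by have /minsetp/andP[_ /forall_inP hit] := minR; apply: hit.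
exact: (minimal_hitting_card tot tr irr free anti minR).
Qed.

(** * Polychromatic coloring *)

Lemma aba_free_trace (T : finType) (lt : rel T) (M : {set {set T}}) (R : {set T}) :
  aba_free lt M -> aba_free lt [set A :\: R | A in M].
Proof.
move=> free _ _ x y z /imsetP[A AM ->] /imsetP[B BM ->] xy yz; rewrite !inE.
move=> /andP[-> xA] /= xB /andP[-> yB] /= yA /andP[-> zA] /=.
exact: (free A B x y z).
Qed.

(** The coloring takes values in [nat]; only the colors below [k] matter. *)
Lemma polychromatic_coloring (T : finType) (lt : rel T) (k : nat)
    (H : {set {set T}}) :
  (forall x y, x != y -> lt x y || lt y x) -> transitive lt -> irreflexive lt ->
  aba_free lt H ->
  exists c : T -> nat, forall A : {set T}, A \in H -> 2 * k - 1 <= #|A| ->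
    forall i, i < k -> exists2 x, x \in A & c x = i.
Proof.
move=> tot tr irr; elim: k H => [|k IHk] H free; first by exists (fun=> 0).
pose large (A : {set T}) := (A \in H) && (2 * k.+1 - 1 <= #|A|).
pose M := [set A | minset large A].
have MP A : A \in M -> large A by rewrite inE => /minsetp.
have freeM : aba_free lt M.
  by move=> A B x y z /MP/andP[AH _] /MP/andP[BH _]; apply: free.
have M0 : set0 \notin M by apply/negP => /MP/andP[_]; rewrite cards0; lia.
have antiM : {in M &, forall B C : {set T}, B \subset C -> B = C}.
  by move=> B C /MP Bl; rewrite inE => /minsetP[_ minC]; apply: minC.
have [R hitR] := shallow_hitting_set tot tr irr freeM M0 antiM.
have [c cP] := IHk _ (aba_free_trace (R := R) freeM).
exists (fun x => if x \in R then k else c x) => A0 A0H cA0 i.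
have [|A minA sAA0] := @minset_exists _ large A0; first by rewrite /large A0H.
have AM : A \in M by rewrite inE.
have [ARn0 AR2] := hitR A AM.
suff ex_color : i < k.+1 ->
    exists2 x, x \in A & (if x \in R then k else c x) = i.
  by move=> /ex_color[x xA cx]; exists x; rewrite ?(subsetP sAA0).
rewrite ltnS leq_eqVlt => /orP[/eqP->|ik].
  by case/set0Pn: ARn0 => x; rewrite inE => /andP[xA xR]; exists x; rewrite ?xR.
have cAR : 2 * k - 1 <= #|A :\: R|.
  by have /andP[_] := MP A AM; have := cardsID R A; lia.
have [x] := cP _ (imset_f (fun B => B :\: R) AM) cAR i ik.
by rewrite inE => /andP[xR xA] cx; exists x => //; rewrite (negPf xR).
Qed.

Theorem theorem2p12 (k : nat) (hk : 1 <= k) (T : finType) (H : {set {set T}})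
    (hH : ABA_free H) :
  exists c : T -> 'I_k,
    forall A : {set T}, A \in H -> 2 * k - 1 <= #|A| ->
      forall i : 'I_k, exists2 x : T, x \in A & c x = i.
Proof.
case: hH => le lin /strict_aba_free free.
have irr : irreflexive (strict le) by move=> x; rewrite /strict eqxx.
have [c cP] :=
  polychromatic_coloring k (strict_total lin) (strict_trans lin) irr free.
exists (fun x => insubd (Ordinal hk) (c x)) => A AH cA i.
have [x xA cx] := cP A AH cA i (ltn_ord i).
by exists x => //; apply: val_inj; rewrite val_insubd cx ltn_ord.
Qed.
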